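(* Let $\alpha\in[0,\pi/2)$ and suppose $A,B\in\mathbb{M}_n$ satisfy $W(A)\subset S_\alpha$ and $W(B)\subset S_\alpha$. Let $A_k$ and $B_k$, $k=1,\ldots,n-1$, denote the $k$-th leading principal submatrices of $A$ and $B$ respectively. Then $$\sec^{3n-2}(\alpha)\,|\det(A+B)|\ \ge\ \left(1+\sum_{k=1}^{n-1}\left|\frac{\det B_k}{\det A_k}\right|\right)|\det A|+\left(1+\sum_{k=1}^{n-1}\left|\frac{\det A_k}{\det B_k}\right|\right)|\det B|+(2^n-2n)\sqrt{|\det AB|}.$$
   Context: $\mathbb{M}_n$ is the set of $n\times n$ complex matrices. The numerical range of $A\in\mathbb{M}_n$ is $W(A)=\{x^*Ax: x\in\mathbb{C}^n,\ x^*x=1\}$, and for $\alpha\in[0,\pi/2)$ the sector is $S_\alpha=\{z\in\mathbb{C}:\Re z>0,\ |\Im z|\le(\Re z)\tan\alpha\}$. The $k$-th leading principal submatrix $A_k$ of $A$ is the $k\times k$ submatrix formed by the first $k$ rows and columns. (A matrix whose numerical range lies in $S_\alpha$ is nonsingular, so the determinants in the denominators are nonzero.) *)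

(* Defs.v *)
From mathcomp Require Import all_boot all_order all_algebra.
From mathcomp Require Import classical_sets reals sequences exp trigo.
From mathcomp Require Import complex.

Set Implicit Arguments.
Unset Strict Implicit.
Unset Printing Implicit Defensive.

Import Order.TTheory GRing.Theory Num.Theory.

Local Open Scope classical_set_scope.
Local Open Scope sesquilinear_scope.
Local Open Scope ring_scope.

Definition numerical_range (R : rcfType) (n : nat) (A : 'M[R[i]]_n) :
    set R[i] :=
  [set z | exists2 x : 'cV[R[i]]_n,
     x ^t* *m x = 1%:M & z = (x ^t* *m A *m x) 0 0].

Definition sector (R : realType) (alpha : R) : set R[i] :=
  [set z | 0 < complex.Re z /\
           `|complex.Im z| <= complex.Re z * tan alpha].

Definition leading_submx (T : Type) (n k : nat) (lekn : (k <= n)%N)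
    (A : 'M[T]_n) : 'M[T]_k :=
  mxsub (widen_ord lekn) (widen_ord lekn) A.

(* [`|z|] on [R[i]] is itself [R[i]]-valued, whereas this modulus is real. *)
Notation cmod := ComplexField.Normc.normc.

(* Main.v *)
Require Import Defs.
From mathcomp Require Import all_boot all_order all_algebra.
From mathcomp Require Import classical_sets reals sequences exp trigo.
From mathcomp Require Import complex.
From mathcomp Require Import zify ring lra.

(** Write A = H + i K with H and K Hermitian; the sector condition says that H
    is positive definite and that |x^* K x| <= tan(alpha) x^* H x for all x. The
    inequality is the one that Hartfiel proved for positive definite matrices,
    applied to the Hermitian parts of A and B and carried over to A, B and A + B
    by comparing |det A_k| with det H_k.

    The comparison is det H_k <= |det A_k| <= sec^k(alpha) det H_k. It comes
    from the identity |det (H + i K)|^2 = det H * det (H + K H^-1 K)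
    ([normsq_det_cartesian]), the inequalities
    0 <= K H^-1 K <= tan^2(alpha) H ([qform_gram], [qform_gram_le]), and the
    monotonicity of the determinant on positive definite matrices
    ([posdef_det_le]).

    For Hartfiel's inequality, let a_k, b_k and c_k be the leading principal
    minors of two positive definite matrices and of their sum. The ratio
    a_(k+1) / a_k is a Schur complement, hence the minimum of the quadratic form
    over the vectors with last coordinate 1 ([posdef_schur_min],
    [posdef_schur_attained]), hence superadditive ([bergstrom]). So c_n is at
    least the product of the sums a_k / a_(k-1) + b_k / b_(k-1), and expanding
    that product gives the inequality ([hartfiel_seq]).

    The k-th summand of the first sum loses the factor sec^k for B_k and sec^n
    for A, and symmetrically for the second sum; the square root loses sec^n. As
    k <= n - 1, the factor sec^(2n-1) covers all of them, and 2n - 1 <= 3n - 2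
    while sec(alpha) >= 1. *)

Set Implicit Arguments.
Unset Strict Implicit.
Unset Printing Implicit Defensive.

Import Order.TTheory GRing.Theory Num.Theory.

Local Open Scope classical_set_scope.
Local Open Scope sesquilinear_scope.
Local Open Scope ring_scope.

(** * Sesquilinear forms and leading submatrices *)

Section Forms.
Variable C : numClosedFieldType.
Implicit Types n k : nat.

Definition qform n (A : 'M[C]_n) (x y : 'cV[C]_n) : C := (x ^t* *m A *m y) 0 0.

Definition posdefmx n (A : 'M[C]_n) : Prop :=
  A ^t* = A /\ forall x, x != 0 -> 0 < qform A x x.

Lemma adjmxM m n p (A : 'M[C]_(m, n)) (B : 'M[C]_(n, p)) :
  (A *m B) ^t* = B ^t* *m A ^t*.
Proof. by rewrite trmx_mul map_mxM. Qed.

Lemma adjmxD m n (A B : 'M[C]_(m, n)) : (A + B) ^t* = A ^t* + B ^t*.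
Proof. by rewrite raddfD /= map_mxD. Qed.

Lemma adjmxZ m n a (A : 'M[C]_(m, n)) : (a *: A) ^t* = a^* *: A ^t*.
Proof. by apply/matrixP=> i j; rewrite !mxE rmorphM. Qed.

Lemma qformDl n (A : 'M[C]_n) x y z :
  qform A (x + y) z = qform A x z + qform A y z.
Proof. by rewrite /qform adjmxD !mulmxDl mxE. Qed.

Lemma qformDr n (A : 'M[C]_n) x y z :
  qform A z (x + y) = qform A z x + qform A z y.
Proof. by rewrite /qform mulmxDr mxE. Qed.

Lemma qformZl n (A : 'M[C]_n) a x y : qform A (a *: x) y = a^* * qform A x y.
Proof. by rewrite /qform adjmxZ -!scalemxAl mxE. Qed.

Lemma qformZr n (A : 'M[C]_n) a x y : qform A x (a *: y) = a * qform A x y.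
Proof. by rewrite /qform -scalemxAr mxE. Qed.

Lemma qformD n (A B : 'M[C]_n) x y :
  qform (A + B) x y = qform A x y + qform B x y.
Proof. by rewrite /qform mulmxDr mulmxDl mxE. Qed.

Lemma qformZ n a (A : 'M[C]_n) x y : qform (a *: A) x y = a * qform A x y.
Proof. by rewrite /qform -scalemxAr -scalemxAl mxE. Qed.

Lemma qform_adj n (A : 'M[C]_n) x y : qform (A ^t*) x y = (qform A y x)^*.
Proof.
have -> : (qform A y x)^* = ((y ^t* *m A *m x) ^t*) 0 0.
  by rewrite /qform [RHS]mxE [in RHS]mxE.
by rewrite !adjmxM trmxCK mulmxA.
Qed.

Lemma qform_mulmx m n (A : 'M[C]_n) (P Q : 'M[C]_(n, m)) x y :
  qform (P ^t* *m A *m Q) x y = qform A (P *m x) (Q *m y).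
Proof. by rewrite /qform adjmxM !mulmxA. Qed.

Lemma qform_delta n (x : 'cV[C]_n) i :
  qform 1%:M x (delta_mx i 0) = (x i 0)^*.
Proof. by rewrite /qform mulmx1 -colE !mxE. Qed.

Lemma qform0r n (A : 'M[C]_n) x : qform A x 0 = 0.
Proof. by rewrite /qform mulmx0 mxE. Qed.

Lemma posdef_qform_ge0 n (A : 'M[C]_n) x : posdefmx A -> 0 <= qform A x x.
Proof.
case=> _ Apos; have [->|x0] := eqVneq x 0; first by rewrite qform0r.
exact/ltW/Apos.
Qed.

Lemma posdefD n (A B : 'M[C]_n) : posdefmx A -> posdefmx B -> posdefmx (A + B).
Proof.
move=> [hA pA] [hB pB]; split=> [|x x0]; first by rewrite adjmxD hA hB.
by rewrite qformD addr_gt0 ?pA ?pB.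
Qed.

Definition lead k (A : 'M[C]_k.+1) : 'M[C]_k := leading_submx (leqnSn k) A.

(** Dropping the last row and column is a cofactor, which makes the adjugate
    available in place of block matrices. *)
Lemma det_lead k (A : 'M[C]_k.+1) :
  \det (lead A) = cofactor A ord_max ord_max.
Proof.
rewrite /cofactor addnn -mul2n exprM sqrrN !expr1n mul1r.
congr (\det _); apply/matrixP=> i j; rewrite !mxE.
by congr (A _ _); apply/val_inj; rewrite /= /bump leqNgt ltn_ord.
Qed.

(** The inclusion of the first coordinates. Leading submatrices are congruences
    by it, so every property stated on quadratic forms is inherited by them. *)
Definition extend n k (lekn : (k <= n)%N) : 'M[C]_(n, k) :=
  \matrix_(i, j) (i == widen_ord lekn j)%:R.

Lemma leading_submxE n k (lekn : (k <= n)%N) (A : 'M[C]_n) :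
  leading_submx lekn A = (extend lekn) ^t* *m A *m extend lekn.
Proof.
apply/matrixP=> i j; rewrite !mxE (bigD1 (widen_ord lekn j)) //=.
rewrite [X in _ + X]big1 => [|l /negPf lj]; last first.
  by rewrite [extend _ l j]mxE lj mulr0.
rewrite addr0 [extend _ _ j]mxE eqxx mulr1 mxE (bigD1 (widen_ord lekn i)) //=.
rewrite big1 => [|l /negPf li]; last by rewrite !mxE li conjC0 mul0r.
by rewrite addr0 !mxE eqxx conjC1 mul1r.
Qed.

Lemma extend_eq0 n k (lekn : (k <= n)%N) (x : 'cV[C]_k) :
  (extend lekn *m x == 0) = (x == 0).
Proof.
apply/eqP/eqP=> [ex0|->]; last by rewrite mulmx0.
have: leading_submx lekn 1%:M *m x = 0.
  by rewrite leading_submxE mulmx1 -mulmxA ex0 mulmx0.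
suff -> : leading_submx lekn (1%:M : 'M[C]_n) = 1%:M by rewrite mul1mx.
by apply/matrixP=> i j; rewrite !mxE -(inj_eq val_inj).
Qed.

Lemma leading_submx_adj n k (lekn : (k <= n)%N) (A : 'M[C]_n) :
  leading_submx lekn (A ^t*) = (leading_submx lekn A) ^t*.
Proof. by apply/matrixP=> i j; rewrite !mxE. Qed.

Lemma qform_leading n k (lekn : (k <= n)%N) (A : 'M[C]_n) x y :
  qform (leading_submx lekn A) x y
    = qform A (extend lekn *m x) (extend lekn *m y).
Proof. by rewrite leading_submxE qform_mulmx. Qed.

Lemma posdef_leading n k (lekn : (k <= n)%N) (A : 'M[C]_n) :
  posdefmx A -> posdefmx (leading_submx lekn A).
Proof.
move=> [hA pA]; split=> [|x x0]; first by rewrite -leading_submx_adj hA.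
by rewrite qform_leading pA ?extend_eq0.
Qed.

(** * Schur complements and determinants of positive definite matrices *)

(** The vector is the normalized last column of the adjugate, that is
    (- A_k^-1 a, 1) where a is the last column of A above the diagonal; the
    scalar det A / det A_k is the Schur complement of A_k in A. *)
Lemma schur_vector k (A : 'M[C]_k.+1) : \det (lead A) != 0 ->
  exists2 v : 'cV[C]_k.+1, v ord_max 0 = 1 &
    A *m v = (\det A / \det (lead A)) *: delta_mx ord_max 0.
Proof.
move=> dA0; exists ((\det (lead A))^-1 *: col ord_max (\adj A)).
  by rewrite !mxE -det_lead mulVf.
by rewrite -scalemxAr colE mulmxA mul_mx_adj mul_scalar_mx scalerA mulrC.
Qed.

Lemma qform_delta_max k (A : 'M[C]_k.+1) v c z :
  A *m v = c *: delta_mx ord_max 0 -> qform A z v = c * (z ord_max 0)^*.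
Proof.
move=> Av; rewrite /qform -mulmxA Av -scalemxAr mxE; congr (_ * _).
by rewrite -qform_delta /qform mulmx1.
Qed.

Lemma posdef_det_gt0 n (A : 'M[C]_n) : posdefmx A -> 0 < \det A.
Proof.
elim: n A => [|k IHk] A pA; first by rewrite det_mx00 ltr01.
have pL : 0 < \det (lead A) by apply/IHk/posdef_leading.
have [v v1 Av] := schur_vector (lt0r_neq0 pL).
have v0 : v != 0.
  by apply/eqP=> v0; move: v1; rewrite v0 mxE => /eqP; rewrite eq_sym oner_eq0.
have := pA.2 _ v0; rewrite (qform_delta_max _ Av) v1 conjC1 mulr1.
by rewrite pmulr_lgt0 ?invr_gt0.
Qed.

(** The Schur complement minimizes the quadratic form over the vectors with last
    coordinate 1: such a vector differs from the Schur vector v by some y with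
    last coordinate 0, and the cross terms vanish because A v is a multiple of
    the last basis vector. *)
Lemma posdef_schur_min k (A : 'M[C]_k.+1) (z : 'cV[C]_k.+1) :
  posdefmx A -> z ord_max 0 = 1 -> \det A / \det (lead A) <= qform A z z.
Proof.
move=> pA z1; have pL := posdef_det_gt0 (posdef_leading (leqnSn k) pA).
have [v v1 Av] := schur_vector (lt0r_neq0 pL).
set c := _ / _ in Av *.
have [y zE] : exists y : 'cV[C]_k.+1, z = v + y.
  by exists (z - v); rewrite addrC subrK.
have y0 : y ord_max 0 = 0.
  by move: z1; rewrite zE mxE v1 => /(canRL (addKr 1)); rewrite addNr.
have yv : qform A y v = 0 by rewrite (qform_delta_max y Av) y0 conjC0 mulr0.
have vy : qform A v y = 0 by rewrite -pA.1 qform_adj yv conjC0.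
rewrite zE qformDl !qformDr yv vy (qform_delta_max v Av) v1 conjC1 mulr1 addr0.
by rewrite add0r lerDl posdef_qform_ge0.
Qed.

Lemma posdef_schur_attained k (A : 'M[C]_k.+1) : posdefmx A ->
  exists2 z : 'cV[C]_k.+1, z ord_max 0 = 1 &
    qform A z z = \det A / \det (lead A).
Proof.
move=> pA; have pL := posdef_det_gt0 (posdef_leading (leqnSn k) pA).
have [v v1 Av] := schur_vector (lt0r_neq0 pL).
by exists v => //; rewrite (qform_delta_max _ Av) v1 conjC1 mulr1.
Qed.

(** A minimum of a sum is at least the sum of the minima. *)
Lemma bergstrom k (A B : 'M[C]_k.+1) : posdefmx A -> posdefmx B ->
  \det A / \det (lead A) + \det B / \det (lead B)
    <= \det (A + B) / \det (lead (A + B)).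
Proof.
move=> pA pB; have [z z1 <-] := posdef_schur_attained (posdefD pA pB).
by rewrite qformD lerD // posdef_schur_min.
Qed.

(** The determinant is the product of the successive Schur complements, and
    each of these, as a minimum of the quadratic form, is monotone. *)
Lemma posdef_det_le n (A B : 'M[C]_n) : posdefmx A -> B ^t* = B ->
  (forall x, qform A x x <= qform B x x) -> \det A <= \det B.
Proof.
elim: n A B => [|k IHk] A B pA hB leAB; first by rewrite !det_mx00.
have pB : posdefmx B.
  by split=> // x x0; apply: lt_le_trans (leAB x); apply: pA.2.
have pLA := posdef_det_gt0 (posdef_leading (leqnSn k) pA).
have pLB := posdef_det_gt0 (posdef_leading (leqnSn k) pB).
have leL : \det (lead A) <= \det (lead B).
  apply: IHk; first exact: posdef_leading.
    by rewrite /lead -leading_submx_adj hB.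
  by move=> x; rewrite !qform_leading.
have leS : \det A / \det (lead A) <= \det B / \det (lead B).
  have [z z1 <-] := posdef_schur_attained pB.
  by apply: le_trans (leAB z); apply: posdef_schur_min.
rewrite -(divfK (lt0r_neq0 pLA) (\det A)) -(divfK (lt0r_neq0 pLB) (\det B)).
apply: ler_pM _ (ltW pLA) leS leL.
by apply/ltW/divr_gt0 => //; apply: posdef_det_gt0.
Qed.

(** * Sectorial matrices and their Hermitian parts *)

(** The numerical range condition freed from the normalization of the vector;
    t stands for the tangent of the half-angle of the sector. *)
Definition sectorial n (t : C) (A : 'M[C]_n) : Prop :=
  forall x, x != 0 ->
    0 < 'Re (qform A x x) /\ `|'Im (qform A x x)| <= t * 'Re (qform A x x).

Definition hermpart n (A : 'M[C]_n) : 'M[C]_n := 2^-1 *: (A + A ^t*).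
(** The Hermitian K of the decomposition A = H + i K, not the skew-Hermitian
    i K itself. *)
Definition skewpart n (A : 'M[C]_n) : 'M[C]_n := 'i / 2 *: (A ^t* - A).

Lemma hermpart_adj n (A : 'M[C]_n) : (hermpart A) ^t* = hermpart A.
Proof.
rewrite /hermpart adjmxZ adjmxD trmxCK addrC; congr (_ *: _).
by apply/CrealP; rewrite realV realn.
Qed.

Lemma skewpart_adj n (A : 'M[C]_n) : (skewpart A) ^t* = skewpart A.
Proof.
apply/matrixP=> i j; rewrite !mxE !(rmorphM, rmorphB, fmorphV, rmorph_nat) /=.
by rewrite conjCi conjCK !mulNr -mulrN opprB.
Qed.

Lemma hermpart_skewpart n (A : 'M[C]_n) : A = hermpart A + 'i *: skewpart A.
Proof.
apply/matrixP=> i j; rewrite !mxE mulrA mulrA -expr2 sqrCi.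
by field.
Qed.

Lemma qform_hermpart n (A : 'M[C]_n) x :
  qform (hermpart A) x x = 'Re (qform A x x).
Proof. by rewrite qformZ qformD qform_adj ReE mulrC. Qed.

Lemma qform_skewpart n (A : 'M[C]_n) x :
  qform (skewpart A) x x = 'Im (qform A x x).
Proof.
rewrite qformZ qformD qform_adj -scaleN1r qformZ ImE mulN1r.
by field.
Qed.

Lemma sectorial_posdef n t (A : 'M[C]_n) :
  sectorial t A -> posdefmx (hermpart A).
Proof.
move=> sA; split=> [|x x0]; first exact: hermpart_adj.
by rewrite qform_hermpart; have [] := sA x x0.
Qed.

Lemma sectorial_leading n k (lekn : (k <= n)%N) t (A : 'M[C]_n) :
  sectorial t A -> sectorial t (leading_submx lekn A).
Proof.
by move=> sA x x0; rewrite qform_leading; apply: sA; rewrite extend_eq0.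
Qed.

Lemma sectorialD n t (A B : 'M[C]_n) :
  sectorial t A -> sectorial t B -> sectorial t (A + B).
Proof.
move=> sA sB x x0; have [pA lA] := sA x x0; have [pB lB] := sB x x0.
rewrite qformD !raddfD /=; split; first exact: addr_gt0.
by rewrite mulrDr (le_trans (ler_normD _ _)) ?lerD.
Qed.

Lemma hermpart_leading n k (lekn : (k <= n)%N) (A : 'M[C]_n) :
  leading_submx lekn (hermpart A) = hermpart (leading_submx lekn A).
Proof. by apply/matrixP=> i j; rewrite !mxE. Qed.

Lemma hermpartD n (A B : 'M[C]_n) :
  hermpart (A + B) = hermpart A + hermpart B.
Proof. by rewrite /hermpart adjmxD -scalerDr addrACA. Qed.

Lemma det_adj n (A : 'M[C]_n) : \det (A ^t*) = (\det A)^*.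
Proof. by rewrite det_map_mx det_tr. Qed.

Section Cartesian.
Variables (n : nat) (H K : 'M[C]_n).
Hypotheses (pH : posdefmx H) (hK : K ^t* = K).

Let unitH : H \in unitmx.
Proof. by rewrite unitmxE unitfE lt0r_neq0 // posdef_det_gt0. Qed.

Let adj_invH : (invmx H) ^t* = invmx H.
Proof. by rewrite trmx_inv map_invmx pH.1. Qed.

Lemma qform_gram x :
  qform (K *m invmx H *m K) x x
    = qform H (invmx H *m K *m x) (invmx H *m K *m x).
Proof. by rewrite -qform_mulmx adjmxM hK adj_invH -!mulmxA mulKVmx. Qed.

Lemma gram_adj : (K *m invmx H *m K) ^t* = K *m invmx H *m K.
Proof. by rewrite !adjmxM hK adj_invH mulmxA. Qed.

(** The product (H + i K) H^-1 (H - i K) equals H + K H^-1 K, and the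
    determinants of its outer factors are conjugate. Bounds on |det (H + i K)|
    thus become bounds on the determinant of a positive definite matrix. *)
Lemma normsq_det_cartesian :
  `|\det (H + 'i *: K)| ^+ 2 = \det H * \det (H + K *m invmx H *m K).
Proof.
have -> : `|\det (H + 'i *: K)| ^+ 2
    = \det (H + 'i *: K) * \det (H - 'i *: K).
  by rewrite normCK -det_adj adjmxD adjmxZ pH.1 hK conjCi scaleNr.
have -> : H + K *m invmx H *m K
    = (H + 'i *: K) *m invmx H *m (H - 'i *: K).
  rewrite mulmxDl mulmxV // mulmxBr !mulmxDl !mul1mx mulmxKV //.
  rewrite -!scalemxAl -!scalemxAr scalerA -expr2 sqrCi scaleN1r.
  by rewrite opprD opprK addrA addrK.
rewrite !det_mulmx det_inv; have := lt0r_neq0 (posdef_det_gt0 pH).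
by move=> dH; field.
Qed.

(** The Ostrowski-Taussky inequality: K H^-1 K is positive semidefinite. *)
Lemma det_posdef_le_cartesian : \det H <= `|\det (H + 'i *: K)|.
Proof.
have dH := posdef_det_gt0 pH.
rewrite -(@ler_pXn2r _ 2) ?nnegrE ?(ltW dH) // normsq_det_cartesian expr2.
rewrite ler_pM2l //; apply: posdef_det_le => //.
  by rewrite adjmxD gram_adj pH.1.
by move=> x; rewrite qformD qform_gram lerDl posdef_qform_ge0.
Qed.

Variable t : C.
Hypotheses (t_ge0 : 0 <= t)
  (leKH : forall x, `|qform K x x| <= t * qform H x x).

(** A Cauchy-Schwarz inequality for K relative to H, which says that H^-1/2 K
    H^-1/2 has norm at most t. With y = H^-1 K x, both y^* K x and the left side
    are equal to y^* H y. *)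
Lemma qform_gram_le x : qform (K *m invmx H *m K) x x <= t ^+ 2 * qform H x x.
Proof.
rewrite qform_gram; set y := invmx H *m K *m x.
have Hy : H *m y = K *m x by rewrite /y -mulmxA mulKVmx.
have yKx : qform K y x = qform H y y by rewrite /qform -!mulmxA Hy.
have xKy : qform K x y = qform H y y.
  by rewrite -hK qform_adj yKx; exact/CrealP/ger0_real/posdef_qform_ge0.
have Kreal z : qform K z z \is Num.real.
  by apply/CrealP; rewrite -qform_adj hK.
have t_real : t^* = t by apply/CrealP/ger0_real.
have quad c : c^* = c -> 2 * c * qform H y y
    <= t * (c ^+ 2 * qform H x x + qform H y y).
  move=> c_real.
  (* polarization: add the upper bound on K at c x + y to the lower bound
     at c x - y *)
  have lep := le_trans (real_ler_norm (Kreal (c *: x + y))) (leKH (c *: x + y)).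
  have len := leKH (c *: x - y).
  rewrite -normrN in len; have {}len := le_trans (real_ler_norm _) len.
  rewrite rpredN Kreal in len; have {}len := len isT.
  have := lerD lep len; rewrite -!scaleN1r.
  rewrite !(qformDl, qformDr, qformZl, qformZr) yKx xKy c_real rmorphN1.
  move=> le4; rewrite -(ler_pM2l (ltr0n _ 2)).
  by apply: etrans le4; congr (_ <= _); ring.
have := t_ge0; rewrite le_eqVlt => /predU1P[t0|t_gt0].
  have := quad 1 (conjC1 _); rewrite -t0 mul0r mulr1 expr0n mul0r.
  by rewrite pmulr_rle0 ?ltr0n.
(* c = t is the choice that optimizes the bound *)
have := quad t t_real; rewrite mulrDr -lerBlDr => le_t.
by rewrite -(ler_pM2l t_gt0); apply: etrans le_t; congr (_ <= _); ring.
Qed.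

(** The reverse of the Ostrowski-Taussky inequality, from
    H + K H^-1 K <= (1 + t^2) H. With t = tan alpha the factor is
    sec^(2n) alpha. *)
Lemma det_cartesian_le :
  `|\det (H + 'i *: K)| ^+ 2 <= (1 + t ^+ 2) ^+ n * \det H ^+ 2.
Proof.
have dH := posdef_det_gt0 pH.
rewrite normsq_det_cartesian expr2 mulrCA ler_pM2l // -detZ.
have t1 : 0 < 1 + t ^+ 2 by rewrite ltr_wpDr ?ltr01 // exprn_ge0.
have t1r : (1 + t ^+ 2)^* = 1 + t ^+ 2 by apply/CrealP/gtr0_real.
apply: posdef_det_le.
- split=> [|x x0]; first by rewrite adjmxD gram_adj pH.1.
  by rewrite qformD qform_gram ltr_wpDr ?posdef_qform_ge0 // pH.2.
- by rewrite adjmxZ t1r pH.1.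
- by move=> x; rewrite qformD qformZ mulrDl mul1r lerD2l qform_gram_le.
Qed.

End Cartesian.

End Forms.

(** * Hartfiel's inequality for sequences of minors *)

Section Hartfiel.
Variable R : rcfType.

Lemma amgm2 (x y : R) : 0 <= x -> 0 <= y -> 2 * Num.sqrt (x * y) <= x + y.
Proof.
move=> x0 y0; rewrite sqrtrM // -{2}(sqr_sqrtr x0) -{2}(sqr_sqrtr y0).
have := sqr_ge0 (Num.sqrt x - Num.sqrt y); nra.
Qed.

Lemma leq_double_exp2 n : (2 * n <= 2 ^ n)%N.
Proof.
case: n => [|n] //; rewrite expnS leq_mul2l; apply/orP; right.
exact: ltn_expl.
Qed.

Lemma sum_pos_ord_const n (z : R) :
  \sum_(k < n.+1 | (0 < k)%N) z = n%:R * z.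
Proof.
by rewrite big_mkcond big_ord_recl /= add0r sumr_const card_ord mulr_natl.
Qed.

Lemma sum_pos_ord_recr n (F : nat -> R) :
  \sum_(k < n.+2 | (0 < k)%N) F k = \sum_(k < n.+1 | (0 < k)%N) F k + F n.+1.
Proof. by rewrite big_mkcond big_ord_recr -big_mkcond. Qed.

(** With x_k = a_k / a_(k-1) and y_k = b_k / b_(k-1), the hypothesis gives
    c_n >= prod (x_k + y_k). In the expansion of this product, 2n of the 2^n
    monomials take the x_k on an initial or final segment and the y_k elsewhere:
    they are the terms of the two sums. The other 2^n - 2n monomials pair up
    under exchange of x and y, each pair has product a_n b_n, and the
    arithmetic-geometric mean inequality bounds their sum. The induction
    multiplies the bound by x_n + y_n and does this pairing one step at a
    time. *)
Lemma hartfiel_seq n (a b c : nat -> R) :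
    (forall k, (k <= n.+1)%N -> 0 < a k) ->
    (forall k, (k <= n.+1)%N -> 0 < b k) ->
    (forall k, (k <= n.+1)%N -> 0 < c k) ->
    a 0 = 1 -> b 0 = 1 -> c 0 = 1 ->
    (forall k, (k <= n)%N ->
       a k.+1 / a k + b k.+1 / b k <= c k.+1 / c k) ->
  (1 + \sum_(k < n.+1 | (0 < k)%N) b k / a k) * a n.+1
  + (1 + \sum_(k < n.+1 | (0 < k)%N) a k / b k) * b n.+1
  + (2 ^+ n.+1 - 2 * n.+1%:R) * Num.sqrt (a n.+1 * b n.+1) <= c n.+1.
Proof.
move=> a_gt0 b_gt0 c_gt0 a0 b0 c0.
elim: n a_gt0 b_gt0 c_gt0 => [|n IHn] a_gt0 b_gt0 c_gt0 step.
  have sum1 (F : nat -> R) : \sum_(k < 1 | (0 < k)%N) F k = 0.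
    by rewrite big_mkcond big_ord1.
  have := step 0 isT; rewrite a0 b0 c0 !divr1.
  by rewrite !(sum1 (fun k => _ k / _ k)) addr0 !mul1r mulr1 subrr mul0r addr0.
set m := n.+1 in a_gt0 b_gt0 c_gt0 step *.
have am : 0 < a m by apply: a_gt0.
have bm : 0 < b m by apply: b_gt0.
have cm : 0 < c m by apply: c_gt0.
have := step m (leqnn m).
set x := a m.+1 / a m; set y := b m.+1 / b m => lexy.
have x0 : 0 < x by rewrite divr_gt0 ?a_gt0.
have y0 : 0 < y by rewrite divr_gt0 ?b_gt0.
have aS : a m.+1 = a m * x by rewrite mulrC divfK ?gt_eqF.
have bS : b m.+1 = b m * y by rewrite mulrC divfK ?gt_eqF.
have cS : c m * (x + y) <= c m.+1 by rewrite mulrC -ler_pdivlMr.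
apply: le_trans cS.
have {IHn} := IHn _ _ _ _.
set P := (_ + _ + _) => IHn.
have leP : P <= c m.
  apply: IHn => k lekn; [apply: a_gt0|apply: b_gt0|apply: c_gt0|apply: step];
  exact: leqW.
apply: le_trans (ler_wpM2r (ltW (addr_gt0 x0 y0)) leP).
rewrite /P {P IHn leP} !(sum_pos_ord_recr n (fun k => _ k / _ k)) -/m aS bS.
set SA := \sum_(k < m | _) b k / a k; set SB := \sum_(k < m | _) a k / b k.
have -> : Num.sqrt (a m * x * (b m * y))
    = Num.sqrt (a m * b m) * Num.sqrt (x * y).
  by rewrite -sqrtrM ?mulr_ge0 ?ltW // mulrACA.
set s := Num.sqrt (a m * b m); set r := Num.sqrt (x * y).
have s0 : 0 <= s by apply: sqrtr_ge0.
have ler : 2 * r <= x + y by apply: amgm2; apply: ltW.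
(* the monomials that stop being segments at this step *)
have pairs : 2 * (s * r) * n%:R <= SA * (a m * y) + SB * (b m * x).
  rewrite mulrC -sum_pos_ord_const !mulr_suml -big_split /=.
  apply: ler_sum => k _.
  have ak : 0 < a k by apply/a_gt0/leqW/ltnW.
  have bk : 0 < b k by apply/b_gt0/leqW/ltnW.
  have -> : s * r = Num.sqrt (b k / a k * (a m * y) * (a k / b k * (b m * x))).
    rewrite /s /r -sqrtrM ?mulr_ge0 ?ltW //; congr (Num.sqrt _).
    by field; rewrite !gt_eqF.
  by apply: amgm2; (apply/ltW/mulr_gt0; [apply: divr_gt0|apply: mulr_gt0]).
have N0 : 0 <= 2 ^+ m - 2 * m%:R :> R.
  by rewrite subr_ge0 -natrX -natrM ler_nat leq_double_exp2.
(* the monomials that were not segments already *)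
have crossing : (2 ^+ m - 2 * m%:R) * s * (2 * r)
    <= (2 ^+ m - 2 * m%:R) * s * (x + y) by rewrite ler_wpM2l ?mulr_ge0.
rewrite -subr_ge0.
rewrite (exprS _ m) in crossing *.
have mE : m%:R = n%:R + 1 :> R by rewrite /m -natr1.
have SE : m.+1%:R = n%:R + 2 :> R by rewrite /m -natr1 -natr1 -addrA.
rewrite SE; rewrite mE in crossing *.
have ea : b m / a m * (a m * x) = b m * x by field; rewrite gt_eqF.
have eb : a m / b m * (b m * y) = a m * y by field; rewrite gt_eqF.
rewrite !mulrDl ea eb.
lra.
Qed.

End Hartfiel.

(** * Leading principal minors *)

Section LeadingMinors.
Variables (C : numClosedFieldType) (n : nat).
Implicit Types A B : 'M[C]_n.

(** A total function of k, so that the minors form the sequences of Hartfiel's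
    inequality. *)
Definition lminor A (k : nat) : C :=
  if (k <= n)%N =P true is ReflectT lekn then \det (leading_submx lekn A)
  else 0.

Lemma lminorE k (lekn : (k <= n)%N) A :
  lminor A k = \det (leading_submx lekn A).
Proof.
rewrite /lminor; case: eqP => [lekn'|//].
by rewrite (bool_irrelevance lekn' lekn).
Qed.

Lemma lminor0 A : lminor A 0 = 1.
Proof. by rewrite (lminorE (leq0n n)) det_mx00. Qed.

Lemma lminor_full A : lminor A n = \det A.
Proof.
rewrite (lminorE (leqnn n)); congr (\det _).
by apply/matrixP=> i j; rewrite mxE; congr (A _ _); apply/val_inj.
Qed.

Lemma lead_leading k (ltkn : (k < n)%N) A :
  lead (leading_submx ltkn A) = leading_submx (ltnW ltkn) A.
Proof. by apply/matrixP=> i j; rewrite !mxE; congr (A _ _); apply/val_inj. Qed.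

Lemma lminor_gt0 A k : posdefmx A -> (k <= n)%N -> 0 < lminor A k.
Proof.
by move=> pA lekn; rewrite (lminorE lekn); apply/posdef_det_gt0/posdef_leading.
Qed.

Lemma lminor_bergstrom A B k : posdefmx A -> posdefmx B -> (k < n)%N ->
  lminor A k.+1 / lminor A k + lminor B k.+1 / lminor B k
    <= lminor (A + B) k.+1 / lminor (A + B) k.
Proof.
move=> pA pB ltkn; rewrite !(lminorE ltkn) !(lminorE (ltnW ltkn)).
rewrite -!lead_leading.
have -> : leading_submx ltkn (A + B)
    = leading_submx ltkn A + leading_submx ltkn B.
  by apply/matrixP=> i j; rewrite !mxE.
by apply: bergstrom; apply: posdef_leading.
Qed.

Lemma lminor_sectorial A (t : C) k : 0 <= t -> sectorial t A -> (k <= n)%N ->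
  lminor (hermpart A) k <= `|lminor A k| /\
  `|lminor A k| ^+ 2 <= (1 + t ^+ 2) ^+ k * lminor (hermpart A) k ^+ 2.
Proof.
move=> t0 sA lekn; rewrite !(lminorE lekn) hermpart_leading.
have sL := sectorial_leading lekn sA.
move: (leading_submx lekn A) sL => L sL.
rewrite {2 3}(hermpart_skewpart L); split.
  by apply: det_posdef_le_cartesian (skewpart_adj L);
    apply: sectorial_posdef sL.
apply: det_cartesian_le (skewpart_adj L) _ t0 _.
  exact: sectorial_posdef sL.
move=> x; rewrite qform_hermpart qform_skewpart.
have [->|x0] := eqVneq x 0; first by rewrite qform0r !raddf0 normr0 mulr0.
by have [] := sL x x0.
Qed.

End LeadingMinors.

(** * From numerical ranges to moduli of minors *)

Section NumericalRange.
Variable R : realType.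
Implicit Types (n : nat) (alpha : R).

Lemma numerical_range_sectorial n (A : 'M[R[i]]_n) alpha :
  numerical_range A `<=` sector alpha -> sectorial (tan alpha)%:C%C A.
Proof.
move=> WA x x0.
pose N := (x ^t* *m x) 0 0.
have N_gt0 : 0 < N.
  have NE : N = \sum_i `|x i 0| ^+ 2.
    by rewrite /N mxE; apply: eq_bigr => i _; rewrite !mxE normCK mulrC.
  rewrite lt0r {2}NE sumr_ge0 ?andbT => [|i _]; last by rewrite exprn_ge0.
  apply: contraNneq x0 => N0; apply/eqP/matrixP=> i j; rewrite mxE ord1.
  have := N0; rewrite NE => /psumr_eq0P N00.
  apply/eqP; rewrite -normr_eq0 -sqrf_eq0; apply/eqP/N00 => // l _.
  by rewrite exprn_ge0.
(* normalize x *)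
pose r : R[i] := (sqrtC N)^-1.
have r_real : r^* = r.
  by apply/CrealP/gtr0_real; rewrite invr_gt0 sqrtC_gt0.
have r2 : r * r = N^-1 by rewrite -expr2 exprVn sqrtCK.
have /WA[] : numerical_range A (N^-1 * qform A x x).
  exists (r *: x); last first.
    by rewrite -/(qform A _ _) qformZl qformZr r_real mulrA r2.
  apply/matrixP=> i j; rewrite !ord1 adjmxZ -scalemxAl -scalemxAr scalerA.
  by rewrite r_real r2 mxE [RHS]mxE -/N mulVf ?eqxx ?gt_eqF.
have NR : N = (complex.Re N)%:C%C by rewrite RRe_real ?gtr0_real.
have M_gt0 : 0 < complex.Re N by rewrite -ltcR -NR.
have zE : qform A x x = (complex.Re N)%:C%C * (N^-1 * qform A x x).
  by rewrite -NR mulrA mulfV ?mul1r ?gt_eqF.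
rewrite -!complexRe -!complexIm.
move: (complex.Re N) (N^-1 * _) M_gt0 zE => m [u v] m0 -> /= u0 vu.
rewrite !mul0r subr0 addr0 normc_def /= expr0n addr0 sqrtr_sqr.
rewrite -rmorphM lecR ltcR mulr_gt0 //; split=> //.
by rewrite normrM gtr0_norm // mulrCA ler_pM2l // mulrC.
Qed.

End NumericalRange.

Section Comparison.
Variable R : rcfType.

Lemma sqrtr_mul_le (q x y x' y' : R) : 0 <= q -> 0 <= x' -> 0 <= y' ->
  x' <= q * x -> y' <= q * y -> Num.sqrt (x' * y') <= q * Num.sqrt (x * y).
Proof.
move=> q0 x'0 y'0 lex ley.
have -> : q * Num.sqrt (x * y) = Num.sqrt (q * x * (q * y)).
  by rewrite mulrACA -expr2 (sqrtrM _ (exprn_ge0 2 q0)) sqrtr_sqr ger0_norm.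
by rewrite ler_wsqrtr // ler_pM.
Qed.

(** Passing from minors of Hermitian parts to moduli of minors costs s^k for the
    k-th ratio, with k < n.+1, and s^(n.+1) for the last factor. *)
Lemma minor_ratio_sum_le n (s : R) (a b alp bet : nat -> R) : 1 <= s ->
    (forall k, (k <= n.+1)%N ->
       [/\ 0 < a k, a k <= alp k & alp k <= s ^+ k * a k]) ->
    (forall k, (k <= n.+1)%N ->
       [/\ 0 < b k, b k <= bet k & bet k <= s ^+ k * b k]) ->
  (1 + \sum_(k < n.+1 | (0 < k)%N) bet k / alp k) * alp n.+1
  <= s ^+ (n + n.+1)
     * ((1 + \sum_(k < n.+1 | (0 < k)%N) b k / a k) * a n.+1).
Proof.
move=> s1 Ha Hb.
have s0 : 0 <= s by apply: le_trans s1.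
have [an aan ale] := Ha _ (leqnn n.+1).
have leS : 1 + \sum_(k < n.+1 | (0 < k)%N) bet k / alp k
    <= s ^+ n * (1 + \sum_(k < n.+1 | (0 < k)%N) b k / a k).
  rewrite mulrDr mulr1 lerD ?exprn_ege1 // mulr_sumr; apply: ler_sum => k _.
  have [ak aak _] := Ha k (ltnW (ltn_ord k)).
  have [bk bbk ble] := Hb k (ltnW (ltn_ord k)).
  rewrite mulrA; apply: ler_pM.
  - exact/ltW/(lt_le_trans bk).
  - by rewrite invr_ge0; apply/ltW/(lt_le_trans ak).
  - apply: le_trans ble _.
    by rewrite ler_wpM2r ?(ltW bk) // ler_weXn2l // -ltnS.
  - by rewrite lef_pV2 // posrE // (lt_le_trans ak).
apply: (@le_trans _ _ (s ^+ n * (1 + \sum_(k < n.+1 | (0 < k)%N) b k / a k)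
                       * (s ^+ n.+1 * a n.+1))).
  apply: ler_pM => //; last exact/ltW/(lt_le_trans an).
  apply: addr_ge0 => //; apply: sumr_ge0 => k _.
  have [ak aak _] := Ha k (ltnW (ltn_ord k)).
  have [bk bbk _] := Hb k (ltnW (ltn_ord k)).
  exact: divr_ge0 (ltW (lt_le_trans bk bbk)) (ltW (lt_le_trans ak aak)).
by rewrite mulrACA -exprD.
Qed.

End Comparison.

Section Assembly.
Variable R : realType.
Implicit Types (n : nat) (alpha : R).

Lemma cos_acute_gt0 alpha : 0 <= alpha -> alpha < pi / 2 -> 0 < cos alpha.
Proof.
move=> alpha0 alpha_lt; apply: cos_gt0_pihalf; rewrite alpha_lt andbT.
by rewrite (lt_le_trans _ alpha0) // oppr_lt0 divr_gt0 ?pi_gt0.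
Qed.

Lemma Re_ratioD_le (u u' v v' w w' : R[i]) :
    0 < u -> 0 < u' -> 0 < v -> 0 < v' -> 0 < w -> 0 < w' ->
    u / u' + v / v' <= w / w' ->
  complex.Re u / complex.Re u' + complex.Re v / complex.Re v'
    <= complex.Re w / complex.Re w'.
Proof.
have ReE (z : R[i]) : 0 < z -> exists x : R, z = x%:C%C.
  by move=> z0; exists (complex.Re z); rewrite RRe_real ?gtr0_real.
have divE (p q : R) : p%:C%C / q%:C%C = (p / q)%:C%C by rewrite rmorphM fmorphV.
move=> /ReE[x ->] /ReE[x' ->] /ReE[y ->] /ReE[y' ->] /ReE[z ->] /ReE[z' ->] /=.
by rewrite !divE -rmorphD lecR.
Qed.

Lemma lminor_bergstrom_Re n (A B : 'M[R[i]]_n) k :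
    posdefmx A -> posdefmx B -> (k < n)%N ->
  complex.Re (lminor A k.+1) / complex.Re (lminor A k)
  + complex.Re (lminor B k.+1) / complex.Re (lminor B k)
    <= complex.Re (lminor (A + B) k.+1) / complex.Re (lminor (A + B) k).
Proof.
move=> pA pB ltkn; have pC := posdefD pA pB; have lekn := ltnW ltkn.
by apply: Re_ratioD_le (lminor_bergstrom pA pB ltkn); apply: lminor_gt0.
Qed.

Lemma lminor_bounds n (A : 'M[R[i]]_n) alpha k :
    0 <= alpha -> alpha < pi / 2 -> sectorial (tan alpha)%:C%C A ->
    (k <= n)%N ->
  let a := complex.Re (lminor (hermpart A) k) in
  [/\ 0 < a, a <= cmod (lminor A k)
    & cmod (lminor A k) <= (cos alpha)^-1 ^+ k * a].
Proof.
move=> alpha0 alpha_lt sA lekn a.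
have cos_gt0 := cos_acute_gt0 alpha0 alpha_lt.
have tan0 : 0 <= tan alpha.
  rewrite /tan divr_ge0 ?(ltW cos_gt0) // sin_ge0_pi //.
  rewrite alpha0 /= (le_trans (ltW alpha_lt)) // ler_pdivrMr // ler_peMr //.
    exact: pi_ge0.
  by rewrite ler1n.
have tanC0 : 0 <= (tan alpha)%:C%C :> R[i] by rewrite ler0c.
have hminor := lminor_gt0 (sectorial_posdef sA) lekn.
have aE : lminor (hermpart A) k = a%:C%C by rewrite RRe_real ?gtr0_real.
have a_gt0 : 0 < a by rewrite -ltcR -aE.
have [le_lo le_up] := lminor_sectorial tanC0 sA lekn.
split=> //; first by rewrite -lecR -aE.
have -> : (cos alpha)^-1 ^+ k * a
    = Num.sqrt ((1 + tan alpha ^+ 2) ^+ k * a ^+ 2).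
  rewrite -cos2_tan2 ?gt_eqF // -exprVn -exprM mulnC exprM -exprMn sqrtr_sqr.
  by rewrite ger0_norm // mulr_ge0 ?exprn_ge0 ?invr_ge0 // ltW.
have n0 : 0 <= cmod (lminor A k).
  by rewrite -ler0c; exact: (normr_ge0 (lminor A k)).
rewrite -(ger0_norm n0) -sqrtr_sqr ler_wsqrtr //.
by move: le_up; rewrite aE -lecR !(rmorphXn, rmorph1, rmorphD, rmorphM).
Qed.

End Assembly.

(** * The determinantal inequality *)

Theorem theorem4p1 (R : realType) (n : nat) (alpha : R) (A B : 'M[R[i]]_n)
    (n_gt0 : (0 < n)%N)
    (alpha_ge0 : 0 <= alpha) (alpha_lt : alpha < pi / 2)
    (WA : numerical_range A `<=` sector alpha)
    (WB : numerical_range B `<=` sector alpha) :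
  (cos alpha)^-1 ^+ (3 * n - 2) * cmod (\det (A + B)) >=
    (1 + \sum_(k < n | (0 < k)%N)
           cmod (\det (leading_submx (ltnW (ltn_ord k)) B)
                 / \det (leading_submx (ltnW (ltn_ord k)) A)))
      * cmod (\det A)
  + (1 + \sum_(k < n | (0 < k)%N)
           cmod (\det (leading_submx (ltnW (ltn_ord k)) A)
                 / \det (leading_submx (ltnW (ltn_ord k)) B)))
      * cmod (\det B)
  + (2 ^+ n - 2 * n%:R) * Num.sqrt (cmod (\det (A *m B))).
Proof.
(* the exponent 2n - 1 that the argument yields, written for n.+1 *)
have leE m : (m + m.+1 <= 3 * m.+1 - 2)%N by lia.
have leE' m : (m.+1 <= m + m.+1)%N by rewrite leq_addl.
case: n A B n_gt0 WA WB => // n A B _ WA WB.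
pose a k := complex.Re (lminor (hermpart A) k).
pose b k := complex.Re (lminor (hermpart B) k).
pose c k := complex.Re (lminor (hermpart (A + B)) k).
pose alp k := cmod (lminor A k); pose bet k := cmod (lminor B k).
have sA := numerical_range_sectorial WA.
have sB := numerical_range_sectorial WB.
pose s := (cos alpha)^-1.
have Ha k : (k <= n.+1)%N ->
  [/\ 0 < a k, a k <= alp k & alp k <= s ^+ k * a k] :=
  lminor_bounds alpha_ge0 alpha_lt sA.
have Hb k : (k <= n.+1)%N ->
  [/\ 0 < b k, b k <= bet k & bet k <= s ^+ k * b k] :=
  lminor_bounds alpha_ge0 alpha_lt sB.
have Hc k : (k <= n.+1)%N -> _ :=
  lminor_bounds alpha_ge0 alpha_lt (sectorialD sA sB).
have sumE (X Y : 'M[R[i]]_n.+1) :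
    \sum_(k < n.+1 | (0 < k)%N)
      cmod (\det (leading_submx (ltnW (ltn_ord k)) X)
            / \det (leading_submx (ltnW (ltn_ord k)) Y))
    = \sum_(k < n.+1 | (0 < k)%N) cmod (lminor X k) / cmod (lminor Y k).
  apply: eq_bigr => k _; rewrite ComplexField.Normc.normcM.
  by rewrite ComplexField.Normc.normcV !(lminorE (ltnW (ltn_ord k))).
rewrite !sumE det_mulmx ComplexField.Normc.normcM -!lminor_full -/s.
have s1 : 1 <= s by rewrite invf_ge1 ?cos_le1 ?cos_acute_gt0.
have s0 : 0 <= s by apply: le_trans s1.
have pA := sectorial_posdef sA; have pB := sectorial_posdef sB.
have a_gt0 k : (k <= n.+1)%N -> 0 < a k by case/Ha.
have b_gt0 k : (k <= n.+1)%N -> 0 < b k by case/Hb.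
have c_gt0 k : (k <= n.+1)%N -> 0 < c k by case/Hc.
have step k : (k <= n)%N -> a k.+1 / a k + b k.+1 / b k <= c k.+1 / c k.
  by move=> lekn; have := lminor_bergstrom_Re pA pB lekn; rewrite -hermpartD.
have zeroth X : complex.Re (@lminor R[i] n.+1 X 0) = 1 by rewrite lminor0.
have hart :=
  hartfiel_seq a_gt0 b_gt0 c_gt0 (zeroth _) (zeroth _) (zeroth _) step.
have [_ c_le _] := Hc _ (leqnn n.+1).
have c_ge0 := le_trans (ltW (c_gt0 _ (leqnn n.+1))) c_le.
apply: le_trans (ler_wpM2r c_ge0 (ler_weXn2l s1 (leE n))).
have sM : 0 <= s ^+ (n + n.+1) by apply: exprn_ge0.
apply: le_trans (ler_wpM2l sM (le_trans hart c_le)).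
rewrite 2!mulrDr; apply: lerD; first apply: lerD.
- exact: minor_ratio_sum_le s1 Ha Hb.
- exact: minor_ratio_sum_le s1 Hb Ha.
rewrite mulrCA ler_wpM2l ?subr_ge0 -?natrX -?natrM ?ler_nat ?leq_double_exp2 //.
have [an aan ale] := Ha _ (leqnn n.+1); have [bn bbn ble] := Hb _ (leqnn n.+1).
apply: (@le_trans _ _ (s ^+ n.+1 * Num.sqrt (a n.+1 * b n.+1))).
  apply: sqrtr_mul_le ale ble; first exact: exprn_ge0.
    exact: ltW (lt_le_trans an aan).
  exact: ltW (lt_le_trans bn bbn).
apply: ler_wpM2r; first exact: sqrtr_ge0.
apply: (ler_weXn2l s1); exact: leE'.
Qed.
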